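(* One has $\mathring\mu_5(2\mid 2)_1\le 3$.
   Context: $\mathbb{R}^n$ and $\Lambda^2(\mathbb{R}^n)$ carry their canonical Euclidean norms. **Rational subspaces.** A linear subspace $B$ of $\mathbb{R}^n$ is rational if it has a basis of vectors with rational coordinates; $\mathfrak{R}_n(e)$ is the set of rational subspaces of $\mathbb{R}^n$ of dimension $e$. **Height.** For $B\in\mathfrak{R}_n(e)$, the Plücker coordinates of $B$ are the $\binom{n}{e}$ minors of size $e\times e$ of an $n\times e$ matrix whose columns form a basis of $B$ (well defined up to a nonzero scalar); choosing a representative $\Xi$ with integer coordinates with gcd $1$, set $H(B)=\|\Xi\|$ (Euclidean norm). **Angles.** For nonzero $X,Y\in\mathbb{R}^n$ let $\psi(X,Y)=\|X\wedge Y\|/(\|X\|\,\|Y\|)$ (sine of the angle). For subspaces $A,B$ of dimensions $d,e\ge 1$ and $t=\min(d,e)$, define $\psi_1(A,B),\dots,\psi_t(A,B)$ recursively: $\psi_1(A,B)=\min\psi(X,Y)$ over $X\in A\setminus\{0\}$, $Y\in B\setminus\{0\}$, attained at unit vectors $X_1,Y_1$; given $(X_1,Y_1),\dots,(X_j,Y_j)$, $\psi_{j+1}(A,B)=\min\psi(X,Y)$ over nonzero $X\in A$ orthogonal to $X_1,\dots,X_j$ and nonzero $Y\in B$ orthogonal to $Y_1,\dots,Y_j$, attained at unit vectors $X_{j+1},Y_{j+1}$. (These numbers do not depend on the choices.) **Irrationality and exponents.** Let $d,e\in\{1,\dots,n-1\}$ with $d+e\le n$ and $1\le j\le\min(d,e)$.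 $\mathfrak{I}_n(d,e)_j$ is the set of $d$-dimensional subspaces $A$ of $\mathbb{R}^n$ with $\dim(A\cap B)<j$ for all $B\in\mathfrak{R}_n(e)$. For $A\in\mathfrak{I}_n(d,e)_j$, $\mu_n(A\mid e)_j\in(0,+\infty]$ is the supremum of the $\beta>0$ such that $\psi_j(A,B)\le H(B)^{-\beta}$ for infinitely many $B\in\mathfrak{R}_n(e)$. Finally $\mathring\mu_n(d\mid e)_j=\inf_{A\in\mathfrak{I}_n(d,e)_j}\mu_n(A\mid e)_j$. *)

(* Defs.v *)
From mathcomp Require Import all_boot all_order all_algebra.
From mathcomp Require Import boolp classical_sets functions cardinality.
From mathcomp Require Import reals constructive_ereal ereal exp.

Set Implicit Arguments.
Unset Strict Implicit.
Unset Printing Implicit Defensive.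

Import Order.TTheory GRing.Theory Num.Theory.

Local Open Scope classical_set_scope.
Local Open Scope ring_scope.

(* The norm of the library on 'cV[R]_n is the sup norm, hence the explicit
   Euclidean norms below. *)
Definition dot (R : realType) (n : nat) (X Y : 'cV[R]_n) : R :=
  \sum_(i < n) X i 0 * Y i 0.

Definition enorm (R : realType) (n : nat) (X : 'cV[R]_n) : R :=
  Num.sqrt (\sum_(i < n) X i 0 ^+ 2).

(* The norm of X /\ Y for the Euclidean structure on the exterior square in
   which the e_i /\ e_k with i < k form an orthonormal basis. *)
Definition wedge_norm (R : realType) (n : nat) (X Y : 'cV[R]_n) : R :=
  Num.sqrt (\sum_(i < n) \sum_(k < n | (i < k)%N)
              (X i 0 * Y k 0 - X k 0 * Y i 0) ^+ 2).

Definition psi (R : realType) (n : nat) (X Y : 'cV[R]_n) : R :=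
  wedge_norm X Y / (enorm X * enorm Y).

Definition rational_subspaces (R : realType) (n e : nat) :
    set {vspace 'cV[R]_n} :=
  [set B | \dim B = e /\
     exists s : seq 'cV[rat]_n,
       basis_of B [seq map_mx (ratr : rat -> R) w | w <- s]].

(* Strictly increasing maps from 'I_e to 'I_n select the rows of the e x e
   minors of an n x e matrix. *)
Definition minor_index (e n : nat) : Type :=
  {f : {ffun 'I_e -> 'I_n} |
    [forall i : 'I_e, forall k : 'I_e, (i < k)%N ==> (f i < f k)%N]}.

Definition minor (R : realType) (n e : nat) (M : 'M[R]_(n, e))
    (I : minor_index e n) : R :=
  \det (rowsub (val I) M).

Definition primitive_plucker (R : realType) (n : nat)
    (B : {vspace 'cV[R]_n}) (Xi : minor_index (\dim B) n -> int) : Prop :=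
  \big[gcdz/0]_I Xi I = 1 /\
  exists M : 'M[R]_(n, \dim B),
    basis_of B [seq col k M | k <- enum 'I_(\dim B)] /\
    exists2 c : R, c != 0 & forall I, (Xi I)%:~R = c * minor M I.

(* For rational B the vector Xi exists and is unique up to sign, so that the
   set below is a singleton; the default value 0 is only taken when B is not
   rational. *)
Definition height (R : realType) (n : nat) (B : {vspace 'cV[R]_n}) : R :=
  xget 0 [set h | exists2 Xi : minor_index (\dim B) n -> int,
                    primitive_plucker Xi &
                    h = Num.sqrt (\sum_I (Xi I)%:~R ^+ 2)].

Definition admissible (R : realType) (n : nat) (A B : {vspace 'cV[R]_n})
    (P : seq ('cV[R]_n * 'cV[R]_n)) : set ('cV[R]_n * 'cV[R]_n) :=
  [set p | [/\ p.1 \in A, p.1 != 0, p.2 \in B, p.2 != 0 &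
     forall q, q \in P -> dot p.1 q.1 = 0 /\ dot p.2 q.2 = 0]].

(* The infimum is a minimum, by compactness, as soon as an admissible pair
   exists. *)
Definition min_psi (R : realType) (n : nat) (A B : {vspace 'cV[R]_n})
    (P : seq ('cV[R]_n * 'cV[R]_n)) : R :=
  inf [set psi p.1 p.2 | p in admissible A B P].

(* A choice of (X_1, Y_1), ..., (X_j, Y_j). *)
Fixpoint principal_pairs (R : realType) (n : nat) (A B : {vspace 'cV[R]_n})
    (j : nat) : seq ('cV[R]_n * 'cV[R]_n) :=
  if j is j'.+1 then
    let P := principal_pairs A B j' in
    rcons P (xget (0, 0)
      [set p | [/\ admissible A B P p, enorm p.1 = 1, enorm p.2 = 1 &
                   psi p.1 p.2 = min_psi A B P]])
  else [::].

(* Meaningful for 1 <= j <= min (\dim A) (\dim B). *)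
Definition angle (R : realType) (n : nat) (j : nat)
    (A B : {vspace 'cV[R]_n}) : R :=
  min_psi A B (principal_pairs A B j.-1).

Definition irrational_subspaces (R : realType) (n d e j : nat) :
    set {vspace 'cV[R]_n} :=
  [set A | \dim A = d /\
     forall B, rational_subspaces e B -> (\dim (A :&: B)%VS < j)%N].

Definition mu (R : realType) (n e j : nat) (A : {vspace 'cV[R]_n}) : \bar R :=
  ereal_sup [set beta%:E | beta in [set beta : R | 0 < beta /\
    infinite_set [set B : {vspace 'cV[R]_n} |
      rational_subspaces e B /\ angle j A B <= height B `^ (- beta)]]].

Definition mu_ring (R : realType) (n d e j : nat) : \bar R :=
  ereal_inf [set mu e j A | A in @irrational_subspaces R n d e j].

(* Main.v *)
Require Import Defs.
From mathcomp Require Import all_boot all_order all_algebra.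
From mathcomp Require Import reals constructive_ereal.
From mathcomp Require Import boolp classical_sets functions cardinality ereal.
From mathcomp Require Import interval_inference topology normedtype sequences.
From mathcomp Require Import exp measure lebesgue_measure.
From mathcomp Require Import zify ring lra.

(** The bound is reached in the limit by planes that already lie in the
    hyperplane R^4 x 0 of R^5 and whose Plucker vector runs over a conic without
    rational points.

    For real numbers t, g with t^2 + g^2 = 3 let A be spanned by
    (1, g, 0, -t, 0) and (0, t, 1, g, 0).  It is the common kernel of three
    linear forms f1, f2, f3, and for a rational plane B with integer Plucker
    coordinates p the contractions of fi /\ fj with p are, up to sign, the
    three numbers a t + b g - c with (a, b, c) equal to
      (p01 + p23, p12 + p03, p13 + 3 p02),  (p24, p04, p14),
      (-p04, p24, p34).
    If x in A and y in B are nonzero, then p is y /\ v with v of size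
    H(B) / |y|, while fi(y) is at most a constant times psi(x, y) |y| because
    fi kills x; so these three numbers are O(H(B) psi(x, y))
    ([wedge_form_le]).  At least one of the three triples (a, b, c) is nonzero
    ([plucker_nonzero_forms]): if the last two vanish then B lies in R^4, and if
    the first one vanishes too, the Plucker relation becomes
    p01^2 + p12^2 = 3 p02^2, which has no nonzero integer solution.  It is here
    that the choice of the conic matters.

    It remains to choose (t, g) on the conic so that |a t + b g - c| is at least
    a constant times max(|a|, |b|)^(-2-e), for all integer triples and a given
    e > 0 ([exists_badly_approximable]).  Then psi_1(A, B) is at least a
    constant times H(B)^(-3-e), and only finitely many B satisfy
    psi_1(A, B) <= H(B)^(-beta) when beta > 3 + e.  Such a t in [0, 1] exists by
    a measure argument.  Multiplying a t + b g - c by its conjugate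
    a t - b g - c gives a quadratic polynomial in t with discriminant
    4 b^2 D, where D = 3 (a^2 + b^2) - c^2 is a nonzero integer, again because
    the conic has no rational point.  Hence |a t + b g - c| <= delta confines t
    to two intervals of radius O(delta / sqrt D) ([near_integer_line]).  For
    fixed (a, b) the sum over c of 1 / sqrt D is bounded
    ([sum_inv_sqrt_diff]), so the bad set for |a|, |b| < 2^k has measure
    O(4^k delta), which for delta of order 4^(-k) 2^(-e k) is the general term
    of a convergent geometric series. *)

Set Implicit Arguments.
Unset Strict Implicit.
Unset Printing Implicit Defensive.
Import Order.TTheory GRing.Theory Num.Theory numFieldNormedType.Exports.
Local Open Scope classical_set_scope.
Local Open Scope ring_scope.

(** * Covering the unit interval *)

Definition intervals_union (R : realType) (s : seq (R * R)) : set R :=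
  \big[setU/set0]_(p <- s) `[p.1 - p.2, p.1 + p.2]%classic.

Lemma measurable_intervals_union (R : realType) (s : seq (R * R)) :
  measurable (intervals_union s : set (measurableTypeR R)).
Proof. by apply: bigsetU_measurable => p _; exact: measurable_itv. Qed.

Lemma measure_intervals_union (R : realType) (s : seq (R * R)) :
  (forall p, p \in s -> 0 <= p.2) ->
  (lebesgue_measure (intervals_union s : set R) <= (\sum_(p <- s) 2 * p.2)%:E)%E.
Proof.
rewrite /intervals_union; elim: s => [|p s IH] hs.
  by rewrite !big_nil measure0.
rewrite !big_cons EFinD.
apply: (le_trans (measureU2 _ _ _)).
- exact: measurable_itv.
- exact: measurable_intervals_union.
apply: leeD; last by apply: IH => q qs; apply: hs; rewrite in_cons qs orbT.
have p2 : 0 <= p.2 by apply: hs; rewrite mem_head.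
have /= -> := lebesgue_measure_itv `[p.1 - p.2, p.1 + p.2]; rewrite lte_fin.
case: ifP => _.
  by rewrite -EFinD lee_fin; lra.
by rewrite lee_fin mulr_ge0.
Qed.

Lemma mem_intervals_union (R : realType) (s : seq (R * R)) (p : R * R) (t : R) :
  p \in s -> `|t - p.1| <= p.2 -> intervals_union s t.
Proof.
move=> ps tp; rewrite /intervals_union (big_rem p) //=; left.
by rewrite /= in_itv /=; move: tp; rewrite ler_norml => /andP[? ?]; apply/andP; split; lra.
Qed.

(** The ratio theta leaves room for a geometric series: the total length of the
    intervals is at most v / (1 - theta) < 1, so they cannot cover [0, 1]. *)
Lemma exists_avoiding_intervals (R : realType) (s : nat -> seq (R * R))
    (v theta : R) :
  0 < theta < 1 -> 0 <= v -> v < 1 - theta ->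
  (forall k p, p \in s k -> 0 <= p.2) ->
  (forall k, \sum_(p <- s k) 2 * p.2 <= v * theta ^+ k) ->
  exists2 t : R, 0 <= t <= 1 &
    forall k p, p \in s k -> p.2 < `|t - p.1|.
Proof.
move=> /andP[th0 th1] v0 vth spos hs; apply: contrapT => noT.
pose F k : set R := intervals_union (s k).
have cover : `[0, 1]%classic `<=` \bigcup_k F k.
  move=> t; rewrite /= in_itv /= => t01; apply: contrapT => nF.
  apply: noT; exists t => // k p ps; rewrite ltNge; apply/negP => tp.
  by apply: nF; exists k => //; exact: mem_intervals_union ps tp.
have mF k : measurable (F k : set (measurableTypeR R)).
  exact: measurable_intervals_union.
have := @measure_sigma_subadditive _ _ _ (@lebesgue_measure R)
  (`[0, 1]%classic) F mF (measurable_itv _) cover.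
have /= -> := @lebesgue_measure_itv R `[0, 1]; rewrite lte_fin ltr01 -EFinB subr0.
apply/negP; rewrite -ltNge.
suff : (\sum_(i <oo) lebesgue_measure (F i) <= (v * (1 - theta)^-1)%:E)%E.
  move=> /le_lt_trans; apply; rewrite lte_fin ltr_pdivrMr ?subr_gt0 //.
  by rewrite mul1r.
apply: lime_le.
  by apply: is_cvg_nneseries => n _ _; exact: measure_ge0.
apply: nearW => n.
apply: (@le_trans _ _ (\sum_(0 <= k < n) (v * theta ^+ k)%:E)%E).
  apply: lee_sum => k _; apply: (le_trans (measure_intervals_union _)).
    exact: spos.
  by rewrite lee_fin.
rewrite sumEFin lee_fin.
have := @geometric_le_lim R n v theta v0 th0.
by rewrite gtr0_norm // => /(_ th1).
Qed.

(** * The conic and the sum of inverse square roots *)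

(** Infinite descent at the prime 3: c is divisible by 3, hence so is a^2 + b^2,
    and since -1 is not a square modulo 3 both a and b are divisible by 3. *)
Lemma conic_anisotropic_nat (a b c : nat) :
  (c ^ 2 = 3 * (a ^ 2 + b ^ 2) -> c = 0)%N.
Proof.
elim/ltn_ind: c a b => c IH a b e.
have [c' ec] : exists c', c = (3 * c')%N.
  have : (3 %| c ^ 2)%N by rewrite e dvdn_mulr.
  by rewrite Euclid_dvdX // => /andP[/dvdnP[c' ->] _]; exists c'; rewrite mulnC.
have e2 : (3 * c' ^ 2 = a ^ 2 + b ^ 2)%N by rewrite ec in e; lia.
have [ea eb] : (a %% 3 = 0 /\ b %% 3 = 0)%N.
  have : ((a %% 3) ^ 2 + (b %% 3) ^ 2 = 0 %[mod 3])%N.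
    by rewrite -modnDm !modnXm modnDm -e2 modnMr.
  have: (a %% 3 < 3)%N by rewrite ltn_mod.
  have: (b %% 3 < 3)%N by rewrite ltn_mod.
  by case: (a %% 3)%N => [|[|[|]]] //; case: (b %% 3)%N => [|[|[|]]].
have [a' ea'] : exists a', a = (3 * a')%N by exists (a %/ 3)%N; lia.
have [b' eb'] : exists b', b = (3 * b')%N by exists (b %/ 3)%N; lia.
have e3 : (c' ^ 2 = 3 * (a' ^ 2 + b' ^ 2))%N.
  apply/eqP; rewrite -(eqn_pmul2l (isT : 0 < 3)%N) e2 ea' eb' !expnMn -mulnDr.
  by rewrite mulnA.
case: (posnP c) => // c0.
by rewrite ec (IH c' _ a' b' e3) //; lia.
Qed.

Lemma conic_anisotropic (a b c : int) :
  c ^+ 2 = 3 * (a ^+ 2 + b ^+ 2) -> [/\ a = 0, b = 0 & c = 0].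
Proof.
move=> e; have sq (z : int) : (`|z| ^ 2)%N%:Z = z ^+ 2 by lia.
have c0 : c = 0.
  apply/eqP; rewrite -absz_eq0; apply/eqP.
  apply: (@conic_anisotropic_nat `|a|%N `|b|%N); apply/eqP.
  by rewrite -eqz_nat PoszM PoszD !sq e.
have /eqP : a ^+ 2 + b ^+ 2 = 0.
  by apply: (@mulfI _ 3) => //; rewrite -e c0 mulr0 expr0n.
by rewrite paddr_eq0 ?sqr_ge0 // !sqrf_eq0 => /andP[/eqP -> /eqP ->].
Qed.

Lemma sum_inv_sqrt (R : realType) (m : nat) :
  \sum_(1 <= u < m.+1) (Num.sqrt u%:R)^-1 <= 2 * Num.sqrt (m%:R : R).
Proof.
elim: m => [|m IH]; first by rewrite big_geq // sqrtr0 mulr0.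
rewrite big_nat_recr //=; apply: le_trans (lerD IH (lexx _)) _.
set x := Num.sqrt m%:R; set y := Num.sqrt m.+1%:R.
have y0 : 0 < y by rewrite sqrtr_gt0 ltr0n.
have x2 : x ^+ 2 = m%:R by rewrite sqr_sqrtr.
have y2 : y ^+ 2 = x ^+ 2 + 1 by rewrite sqr_sqrtr // x2 natr1.
rewrite -(ler_pM2r y0) mulrDl mulVf ?gt_eqF //.
have := sqr_ge0 (x - y); nra.
Qed.

(** With m the largest integer such that m^2 < N, the term c = m contributes at
    most 1, and N - c^2 >= m (m - c) for c < m bounds the other terms by
    a sum of inverse square roots.  The bound does not depend on N. *)
Lemma sum_inv_sqrt_diff (R : realType) (N : nat) :
  \sum_(0 <= c < N | (c ^ 2 < N)%N) (Num.sqrt (N - c ^ 2)%:R)^-1 <= (3 : R).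
Proof.
case: (posnP N) => [->|N0]; first by rewrite big_geq.
have [m mN Nm] : exists2 m, (m ^ 2 < N)%N & (N <= m.+1 ^ 2)%N.
  have ex0 : exists m, (m ^ 2 < N)%N by exists 0%N.
  have bd m : (m ^ 2 < N)%N -> (m <= N)%N by nia.
  case: (ex_maxnP ex0 bd) => m h1 h2; exists m => //.
  by rewrite leqNgt; apply/negP => /h2; rewrite ltnn.
have -> : \sum_(0 <= c < N | (c ^ 2 < N)%N) (Num.sqrt (N - c ^ 2)%:R)^-1
    = \sum_(0 <= c < m.+1) (Num.sqrt (N - c ^ 2)%:R)^-1 :> R.
  have mN' : (m.+1 <= N)%N by nia.
  rewrite (big_cat_nat (leq0n m.+1) mN') //= [X in _ + X]big_nat_cond [X in _ + X]big1 ?addr0.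
    rewrite big_nat_cond [RHS]big_nat_cond; apply: eq_bigl => c.
    by apply/idP/idP => /andP[/andP[_ h] _]; rewrite /= h ?andbT //=; nia.
  by move=> c /andP[/andP[h1 _] h2]; exfalso; nia.
rewrite big_nat_recr //=.
have h1 : (Num.sqrt (N - m ^ 2)%:R)^-1 <= (1 : R).
  rewrite invf_le1 ?sqrtr_gt0 ?ltr0n ?subn_gt0 //.
  by rewrite -{1}sqrtr1 ler_wsqrtr // ler1n subn_gt0.
suff : \sum_(0 <= c < m) (Num.sqrt (N - c ^ 2)%:R)^-1 <= (2 : R).
  by move: h1; lra.
case: (posnP m) => [->|m0]; first by rewrite big_geq.
have sm0 : 0 < Num.sqrt (m%:R : R) by rewrite sqrtr_gt0 ltr0n.
apply: (@le_trans _ _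
  (\sum_(0 <= c < m) (Num.sqrt m%:R)^-1 * (Num.sqrt (m - c)%:R)^-1)).
  rewrite big_nat_cond [leRHS]big_nat_cond; apply: ler_sum => c /andP[/andP[_ cm] _].
  rewrite -invfM -sqrtrM // -natrM lef_pV2 ?posrE ?sqrtr_gt0 ?ltr0n; try nia.
  by rewrite ler_wsqrtr // ler_nat; nia.
rewrite -big_distrr /= big_nat_rev /=.
have -> : \sum_(0 <= i < m) (Num.sqrt (m - (0 + m - i.+1))%:R)^-1
   = \sum_(1 <= u < m.+1) (Num.sqrt u%:R)^-1 :> R.
  rewrite big_add1 /= big_nat [RHS]big_nat; apply: eq_bigr => i /andP[_ im].
  by congr (Num.sqrt _%:R)^-1; lia.
rewrite mulrC ler_pdivrMr //; exact: sum_inv_sqrt.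
Qed.

(** * Small values of the linear form on the conic *)

(** The factor of x^2 - y^2 whose two terms have the same sign is at least y in
    absolute value, so the other one is small. *)
Lemma near_root (R : realFieldType) (x y e : R) :
  0 < y -> 0 <= e -> `|x ^+ 2 - y ^+ 2| <= e * y -> `|x - y| <= e \/ `|x + y| <= e.
Proof.
move=> y0 e0; rewrite subr_sqr normrM => h.
case: (lerP 0 x) => x0; [left|right].
  rewrite -(ler_pM2r y0); apply: le_trans h; apply: ler_wpM2l => //.
  by rewrite ger0_norm; lra.
rewrite -(ler_pM2r y0) mulrC; apply: le_trans h; rewrite mulrC [leRHS]mulrC.
apply: ler_wpM2l => //.
by rewrite ltr0_norm; lra.
Qed.

(** The conjugate of a t + b g - c, with g = sqrt (3 - t^2), is of size |b|, so
    the quadratic polynomial (a t - c)^2 - b^2 (3 - t^2) is at most 4 delta |b|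
    in absolute value.  Its roots differ by 2 |b| s / r2, which bounds the
    distance from t to the nearest one.  If D < 0 there is no real root, the
    polynomial is at least b^2 / r2, and the smallness of delta excludes this
    case.  When b = 0 the two roots coincide with c / a. *)
Lemma near_integer_line (R : realType) (a b c : int) (t delta : R) :
  0 <= t <= 1 -> 0 <= delta ->
  delta * 10 * (a ^+ 2 + b ^+ 2)%:~R < 1 ->
  (a != 0) || (b != 0) ->
  `|a%:~R * t + b%:~R * Num.sqrt (3 - t ^+ 2) - c%:~R| <= delta ->
  let D := 3 * (a ^+ 2 + b ^+ 2) - c ^+ 2 in
  let r2 : R := (a ^+ 2 + b ^+ 2)%:~R in
  let s : R := Num.sqrt D%:~R in
  [/\ 0 < D & `|t - (a%:~R * c%:~R + b%:~R * s) / r2| <= 5 * delta / s \/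
              `|t - (a%:~R * c%:~R - b%:~R * s) / r2| <= 5 * delta / s].
Proof.
move=> /andP[t0 t1] d0 dr ab0 hd D r2 s.
set g := Num.sqrt (3 - t ^+ 2) in hd.
have g0 : 0 <= g by exact: sqrtr_ge0.
have g2 : g ^+ 2 = 3 - t ^+ 2 by rewrite sqr_sqrtr //; nra.
have g1 : g <= 7 / 4 by rewrite -(ler_pXn2r (ltn0Sn 1)) ?nnegrE // g2; nra.
have rpos : 1 <= r2.
  rewrite ler1z -gtz0_ge1 lt_neqAle eq_sym addr_ge0 ?sqr_ge0 // andbT.
  by rewrite paddr_eq0 ?sqr_ge0 // !sqrf_eq0 negb_and.
have d1 : delta < 1 / 10.
  have : delta * 10 * 1 <= delta * 10 * r2 by rewrite ler_wpM2l ?mulr_ge0.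
  by move: dr; rewrite -/r2; lra.
have D0 : D != 0.
  apply/eqP => /eqP; rewrite subr_eq0 => /eqP /esym /conic_anisotropic[a0 b0 _].
  by move: ab0; rewrite a0 b0 eqxx.
have r2E : r2 = a%:~R ^+ 2 + b%:~R ^+ 2 by rewrite /r2 rmorphD /= !rmorphXn.
have DE : D%:~R = 3 * r2 - c%:~R ^+ 2 :> R.
  by rewrite /D rmorphB /= rmorphM /= -/r2 rmorphXn.
have r0 : 0 < r2 by lra.
have [b0|b0] := eqVneq b 0.
  move: hd; rewrite b0 mul0r addr0 => hd.
  have a0 : a != 0 by move: ab0; rewrite b0 eqxx orbF.
  have a1 : (1 : R) <= `|a%:~R| by rewrite -intr_norm ler1z -gtz0_ge1 normr_gt0.
  have ca : `|c| <= `|a|.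
    rewrite -ltzD1 -(ltr_int R) rmorphD /= !intr_norm.
    have h : `|c%:~R| - `|a%:~R * t| <= (delta : R).
      by apply: le_trans hd; rewrite distrC; exact: lerB_dist.
    have : `|a%:~R * t| <= `|a%:~R : R|.
      by rewrite normrM ler_piMr // ger0_norm.
    by move: h d1; lra.
  have Dp : 0 < D.
    have c2 : c ^+ 2 <= a ^+ 2 by rewrite -(real_normK (num_real c)) -(real_normK (num_real a)) ler_sqr ?nnegrE.
    have a2 : 0 < a ^+ 2 by rewrite exprn_even_gt0.
    by clear -c2 a2 b0; rewrite /D b0; lia.
  split => //; left.
  have s0 : 0 < s by rewrite sqrtr_gt0 ltr0z.
  rewrite mul0r addr0.
  have r2a : r2 = a%:~R ^+ 2 by rewrite r2E b0 expr0n addr0.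
  rewrite ler_pdivlMr // -(ler_pM2l r0) mulrA -{1}(gtr0_norm r0) -normrM.
  rewrite mulrBr [r2 * (_ / _)]mulrC divfK ?gt_eqF // r2a.
  have -> : a%:~R ^+ 2 * t - a%:~R * c%:~R = a%:~R * (a%:~R * t - c%:~R) :> R by ring.
  have s2 : s ^+ 2 <= 4 * a%:~R ^+ 2.
    rewrite sqr_sqrtr ?ler0z ?ltW // DE r2a.
    have := sqr_ge0 (c%:~R : R); have := sqr_ge0 (a%:~R : R); lra.
  have sa : s <= 2 * `|a%:~R|.
    rewrite -(ler_pXn2r (ltn0Sn 1)) ?nnegrE ?(ltW s0) ?mulr_ge0 //.
    by rewrite exprMn (real_normK (num_real _)); lra.
  rewrite -[a%:~R ^+ 2](real_normK (num_real _)) normrM.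
  apply: (@le_trans _ _ (`|a%:~R| * delta * (2 * `|a%:~R|))).
    by apply: ler_pM; rewrite ?mulr_ge0 ?(ltW s0) //; exact: ler_wpM2l.
  have -> : `|a%:~R| * delta * (2 * `|a%:~R|) = (delta * `|a%:~R| ^+ 2) * 2 :> R by ring.
  have -> : `|a%:~R| ^+ 2 * (5 * delta) = (delta * `|a%:~R| ^+ 2) * 5 :> R by ring.
  by rewrite ler_wpM2l ?mulr_ge0 // ler_nat.
have b1 : (1 : R) <= `|b%:~R| by rewrite -intr_norm ler1z -gtz0_ge1 normr_gt0.
set u : R := a%:~R * t - c%:~R.
(* the product of the form and its conjugate *)
have Q : `|u ^+ 2 - b%:~R ^+ 2 * g ^+ 2| <= delta * (4 * `|b%:~R|).
  have -> : u ^+ 2 - b%:~R ^+ 2 * g ^+ 2 = (u + b%:~R * g) * (u - b%:~R * g) by ring.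
  have hd' : `|u + b%:~R * g| <= delta.
    by move: hd; rewrite (_ : _ - _ = u + b%:~R * g) // /u; ring.
  rewrite normrM; apply: ler_pM => //.
  have -> : u - b%:~R * g = (u + b%:~R * g) - 2 * g * b%:~R by ring.
  apply: le_trans (ler_normB _ _) _; rewrite normrM ger0_norm ?mulr_ge0 //.
  by nra.
have QE : r2 * (u ^+ 2 - b%:~R ^+ 2 * g ^+ 2) =
  (r2 * t - a%:~R * c%:~R) ^+ 2 - b%:~R ^+ 2 * D%:~R.
  by rewrite g2 DE r2E /u; ring.
set x := r2 * t - a%:~R * c%:~R in QE.
have Q2 : `|x ^+ 2 - b%:~R ^+ 2 * D%:~R| <= delta * (4 * `|b%:~R|) * r2.
  by rewrite -QE normrM gtr0_norm // mulrC ler_wpM2r // ltW.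
have small : delta * 4 * r2 < 1.
  have dr0 : 0 <= delta * r2 by apply: mulr_ge0 => //; exact: ltW.
  by move: dr dr0; rewrite -/r2; lra.
have Dp : 0 < D.
  rewrite ltNge; apply/negP => Dn.
  have : 0 < - D by rewrite oppr_gt0 lt_neqAle D0.
  rewrite gtz0_ge1 lerNr.
  rewrite -(ler_int R) rmorphN1 => D1.
  have : `|b%:~R| ^+ 2 <= x ^+ 2 - b%:~R ^+ 2 * (D%:~R : R).
    have := sqr_ge0 x; rewrite (real_normK (num_real _)); have := sqr_ge0 (b%:~R : R); nra.
  move=> /le_trans /(_ (ler_norm _)) /le_trans /(_ Q2); nra.
split => //.
have s0 : 0 < s by rewrite sqrtr_gt0 ltr0z.
have s2 : s ^+ 2 = D%:~R by rewrite sqr_sqrtr // ler0z ltW.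
have y0 : 0 < `|b%:~R| * s by rewrite mulr_gt0 //; lra.
have := @near_root R x (`|b%:~R| * s) (4 * delta * r2 / s) y0.
rewrite !exprMn (real_normK (num_real _)) s2 => nr.
have conv (y : R) : `|x - y| <= 4 * delta * r2 / s ->
    `|t - (a%:~R * c%:~R + y) / r2| <= 5 * delta / s.
  move=> h.
  have -> : t - (a%:~R * c%:~R + y) / r2 = (x - y) / r2.
    by rewrite /x -addrA -opprD mulrBl mulrAC mulfV ?gt_eqF // mul1r.
  rewrite normrM normfV (gtr0_norm r0) ler_pdivrMr //; apply: le_trans h _.
  have -> : 4 * delta * r2 / s = delta * r2 / s * 4 by ring.
  have -> : 5 * delta / s * r2 = delta * r2 / s * 5 by ring.
  by rewrite ler_wpM2l ?ler_nat // !mulr_ge0 ?invr_ge0 ?(ltW r0) ?(ltW s0).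
have e0 : 0 <= 4 * delta * r2 / s by rewrite !mulr_ge0 ?invr_ge0 ?(ltW r0) ?(ltW s0).
have {nr Q2} : `|x - `|b%:~R| * s| <= 4 * delta * r2 / s \/
   `|x + `|b%:~R| * s| <= 4 * delta * r2 / s.
  apply: nr => //; apply: le_trans Q2 _.
  rewrite le_eqVlt; apply/orP; left; apply/eqP.
  have sn : s != 0 by exact: lt0r_neq0.
  have -> : 4 * delta * r2 / s * (`|b%:~R| * s) =
    delta * (4 * `|b%:~R|) * r2 * (s / s) by ring.
  by rewrite mulfV // mulr1.
have nb : `|b%:~R : R| = b%:~R \/ `|b%:~R : R| = - b%:~R.
  have [h|/ltW h] := lerP 0 (b%:~R : R).
    by left; exact: ger0_norm.
  by right; exact: ler0_norm.
by case: nb => ->; rewrite ?mulNr ?opprK => -[] h; [left|right|right|left];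
   apply: conv; rewrite ?opprK.
Qed.

(** * Badly approximable points of the conic *)

Definition conic_bound (a b : int) : nat := (3 * (`|a| ^ 2 + `|b| ^ 2))%N.

(** The two intervals, given by centre and radius, to which [near_integer_line]
    confines t for the triple (a, b, c). *)
Definition root_pair (R : realType) (delta : R) (a b : int) (c : nat) : seq (R * R) :=
  let s := Num.sqrt (conic_bound a b - c ^ 2)%:R in
  let r2 := (a ^+ 2 + b ^+ 2)%:~R in
  [:: ((a%:~R * c%:R + b%:~R * s) / r2, 5 * delta / s);
      ((a%:~R * c%:R - b%:~R * s) / r2, 5 * delta / s)].

(** Only triples with c >= 0 are listed: changing the sign of (a, b, c) does not
    change the absolute value of the form. *)
Definition bad_intervals (R : realType) (delta : R) (a b : int) : seq (R * R) :=
  flatten [seq root_pair delta a b c |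
    c <- [seq c <- index_iota 0 (conic_bound a b) | (c ^ 2 < conic_bound a b)%N]].

Definition int_range (K : nat) : seq int := [seq i%:Z - K%:Z | i <- iota 0 K.*2].

Definition bad_level (R : realType) (delta : R) (K : nat) : seq (R * R) :=
  flatten [seq bad_intervals delta a b | a <- int_range K, b <- int_range K].

Lemma mem_int_range (K : nat) (a : int) : `|a| < K%:Z -> a \in int_range K.
Proof.
move=> h; apply/mapP; exists (absz (a + K%:Z)); last lia.
rewrite mem_iota; lia.
Qed.

Lemma sum_bad_intervals (R : realType) (delta : R) (a b : int) :
  0 <= delta -> \sum_(p <- bad_intervals delta a b) 2 * p.2 <= 60 * delta.
Proof.
move=> d0; rewrite /bad_intervals big_flatten /= big_map big_filter /=.
apply: (@le_trans _ _ (\sum_(0 <= c < conic_bound a b | (c ^ 2 < conic_bound a b)%N)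
   20 * delta * (Num.sqrt (conic_bound a b - c ^ 2)%:R)^-1)).
  apply: ler_sum => c _; rewrite /root_pair !big_cons big_nil /=; lra.
rewrite -big_distrr /=; have := sum_inv_sqrt_diff R (conic_bound a b).
by move=> /(ler_wpM2l (mulr_ge0 (ler0n _ 20) d0)); lra.
Qed.

Lemma ler_sum_seq_const (R : realType) (T : Type) (s : seq T) (F : T -> R) (C : R) :
  (forall x, F x <= C) -> \sum_(x <- s) F x <= (size s)%:R * C.
Proof.
move=> FC; apply: (@le_trans _ _ (\sum_(x <- s) C)); first exact: ler_sum.
by rewrite big_const_seq count_predT iter_addr_0 mulr_natl.
Qed.

Lemma sum_bad_level (R : realType) (delta : R) (K : nat) :
  0 <= delta -> \sum_(p <- bad_level delta K) 2 * p.2 <= 240 * K%:R ^+ 2 * delta.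
Proof.
move=> d0; rewrite /bad_level big_flatten big_allpairs_dep /=.
have sz : size (int_range K) = K.*2 by rewrite size_map size_iota.
apply: (@le_trans _ _ (K.*2%:R * (K.*2%:R * (60 * delta)))).
  rewrite -sz; apply: ler_sum_seq_const => a.
  by apply: ler_sum_seq_const => b; exact: sum_bad_intervals.
by rewrite -muln2 natrM; lra.
Qed.

Lemma bad_level_radius (R : realType) (delta : R) (K : nat) p :
  0 <= delta -> p \in bad_level delta K -> 0 <= p.2.
Proof.
move=> d0 /flattenP[_ /allpairsP[[a b] [_ _ ->]] /flattenP[_ /mapP[c _ ->]]].
by rewrite !inE => /orP[] /eqP -> /=; rewrite divr_ge0 ?mulr_ge0 ?sqrtr_ge0.
Qed.

Lemma near_integer_line_nat (R : realType) (a b : int) (c K : nat) (t delta : R) :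
  0 <= t <= 1 -> 0 <= delta -> 20 * K%:R ^+ 2 * delta < 1 ->
  (a != 0) || (b != 0) -> `|a| < K%:Z -> `|b| < K%:Z ->
  `|a%:~R * t + b%:~R * Num.sqrt (3 - t ^+ 2) - c%:R| <= delta ->
  exists2 p, p \in bad_level delta K & `|t - p.1| <= p.2.
Proof.
move=> t01 d0 dK ab0 aK bK h.
have r2K : (a ^+ 2 + b ^+ 2)%:~R <= 2 * (K%:R : R) ^+ 2.
  have -> : 2 * (K%:R : R) ^+ 2 = (2 * K%:Z ^+ 2)%:~R.
    by rewrite rmorphM /= rmorphXn.
  rewrite ler_int mulr_natl mulr2n lerD //;
  by rewrite -[X in X <= _](real_normK (num_real _)) ler_sqr ?nnegrE // ltW.
have hd : delta * 10 * (a ^+ 2 + b ^+ 2)%:~R < 1.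
  apply: le_lt_trans dK.
  have := ler_wpM2l (mulr_ge0 (ler0n _ 10) d0) r2K; lra.
have := @near_integer_line R a b c%:Z t delta t01 d0 hd ab0 h.
have fE : (conic_bound a b)%:Z = 3 * (a ^+ 2 + b ^+ 2) by rewrite /conic_bound; lia.
rewrite /= -fE => -[D0 hp].
have cN : (c ^ 2 < conic_bound a b)%N by clear -D0; lia.
have sE : ((conic_bound a b)%:Z - c%:Z ^+ 2)%:~R = (conic_bound a b - c ^ 2)%:R :> R.
  rewrite -[RHS]/((conic_bound a b - c ^ 2)%N%:Z%:~R); congr (_%:~R); clear -cN; lia.
rewrite sE in hp.
have mem p : p \in root_pair delta a b c -> p \in bad_level delta K.
  move=> hp'; apply/flattenP; exists (bad_intervals delta a b).
    by apply/allpairsP; exists (a, b); split => //; exact: mem_int_range.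
  apply/flattenP; exists (root_pair delta a b c) => //.
  apply/mapP; exists c => //; rewrite mem_filter cN mem_index_iota /=.
  by clear -cN; nia.
by case: hp => hp;
  [exists (head (0, 0) (root_pair delta a b c))
  | exists (last (0, 0) (root_pair delta a b c))] => //;
  apply: mem; rewrite !inE eqxx ?orbT.
Qed.

(** The bad parameters for |a|, |b| < 2^k have measure at most
    240 * 4^k * kappa * (theta / 4)^k = 240 kappa theta^k, whose sum over k is
    less than 1 as soon as 1000 kappa = 1 - theta.  The points outside all bad
    sets satisfy the conclusion. *)
Lemma exists_badly_approximable (R : realType) (theta : R) :
  0 < theta < 1 ->
  exists2 kappa : R, 0 < kappa & exists2 t : R, 0 <= t <= 1 &
    forall (k : nat) (a b c : int), (a != 0) || (b != 0) ->
      `|a| < (2 ^ k)%N%:Z -> `|b| < (2 ^ k)%N%:Z ->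
      kappa * (theta / 4) ^+ k <
        `|a%:~R * t + b%:~R * Num.sqrt (3 - t ^+ 2) - c%:~R|.
Proof.
move=> /andP[th0 th1].
have [kappa k0 kE] : exists2 kappa : R, 0 < kappa & 1000 * kappa = 1 - theta.
  by exists ((1 - theta) / 1000); lra.
exists kappa => //.
pose delta k := kappa * (theta / 4) ^+ k.
have d0 k : 0 <= delta k.
  by apply: mulr_ge0; [exact: ltW | apply: exprn_ge0; lra].
have dE (k : nat) : ((2 ^ k)%N%:R : R) ^+ 2 * delta k = kappa * theta ^+ k.
  rewrite /delta mulrCA natrX -exprM mulnC exprM -exprMn.
  suff -> : 2 ^+ 2 * (theta / 4) = theta by [].
  by field.
have [|||||t t01 ht] := @exists_avoiding_intervals R
    (fun k => bad_level (delta k) (2 ^ k)) (240 * kappa) theta.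
- by rewrite th0.
- by rewrite mulr_ge0 ?ler0n ?(ltW k0).
- by lra.
- by move=> k p; exact: bad_level_radius.
- move=> k; apply: le_trans (sum_bad_level _ (d0 k)) _.
  by rewrite -mulrA dE mulrA.
exists t => // k a b c ab0 aK bK; rewrite -/(delta k) ltNge; apply/negP => h.
have dK : 20 * (2 ^ k)%N%:R ^+ 2 * delta k < 1.
  rewrite -mulrA dE.
  have : kappa * theta ^+ k <= kappa.
    by rewrite ler_piMr ?(ltW k0) // exprn_ile1 // ltW.
  by lra.
case: (ltrP c 0) => c0.
  have [||||p ps] := @near_integer_line_nat R (- a) (- b) `|c|%N (2 ^ k) t (delta k) t01 (d0 k) dK.
  - by rewrite !oppr_eq0.
  - by rewrite normrN.
  - by rewrite normrN.
  - apply: le_trans h; rewrite le_eqVlt; apply/orP; left; apply/eqP.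
    rewrite -normrN; congr `|_|.
    have -> : (`|c|%N%:R : R) = - c%:~R.
      by rewrite -[LHS]/((`|c|%N%:Z)%:~R) -rmorphN /=; congr (_%:~R); lia.
    by rewrite !rmorphN /=; ring.
  by have := ht k p ps; rewrite ltNge => /negP.
have [||||p ps] := @near_integer_line_nat R a b `|c|%N (2 ^ k) t (delta k) t01 (d0 k) dK.
- by [].
- by [].
- by [].
- suff -> : (`|c|%N%:R : R) = c%:~R by [].
  by rewrite -[LHS]/((`|c|%N%:Z)%:~R); congr (_%:~R); lia.
by have := ht k p ps; rewrite ltNge => /negP.
Qed.

(** * Angles and Plucker vectors of planes *)

Section Norms.
Variables (R : realType) (n : nat).
Implicit Types x y : 'cV[R]_n.

Lemma coord_wedge_norm x y (i j : 'I_n) :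
  `|x i 0 * y j 0 - x j 0 * y i 0| <= wedge_norm x y.
Proof.
rewrite /wedge_norm -sqrtr_sqr ler_wsqrtr //.
have nn (i' : 'I_n) : 0 <= \sum_(k < n | (i' < k)%N) (x i' 0 * y k 0 - x k 0 * y i' 0) ^+ 2.
  by apply: sumr_ge0 => k _; exact: sqr_ge0.
have lt_case (a b : 'I_n) : (a < b)%N -> (x a 0 * y b 0 - x b 0 * y a 0) ^+ 2 <=
   \sum_(i < n) \sum_(k < n | (i < k)%N) (x i 0 * y k 0 - x k 0 * y i 0) ^+ 2.
  move=> ab; rewrite (bigD1 a) //= (bigD1 b) //= -addrA lerDl addr_ge0 //.
    by apply: sumr_ge0 => k _; exact: sqr_ge0.
  exact: sumr_ge0.
case: (ltngtP i j) => [|ji|/val_inj ->]; first exact: lt_case.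
  by rewrite -sqrrN opprB; exact: lt_case.
by rewrite subrr expr0n sumr_ge0.
Qed.

Lemma enorm_le_coord x :
  x != 0 -> exists2 i, x i 0 != 0 & enorm x <= n%:R * `|x i 0|.
Proof.
move=> x0.
have [i0 xi0] : exists i, x i 0 != 0.
  apply/existsP; apply: contraNT x0; rewrite negb_exists => /forallP h.
  by apply/eqP/colP => i; move: (h i); rewrite negbK mxE => /eqP.
case: (@arg_maxP _ _ _ i0 predT (fun i => `|x i 0|) isT) => i _ imax.
exists i.
  by rewrite -normr_gt0; apply: lt_le_trans (imax i0 isT); rewrite normr_gt0.
have n1 : (1 : R) <= n%:R by rewrite ler1n; case: n i {imax} => // -[].
have nx0 : 0 <= n%:R * `|x i 0| by rewrite mulr_ge0.
rewrite /enorm -[leRHS]ger0_norm // -sqrtr_sqr ler_wsqrtr //.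
apply: (@le_trans _ _ (\sum_(k < n) `|x i 0| ^+ 2)).
  apply: ler_sum => k _; rewrite -(real_normK (num_real (x k 0))).
  by rewrite ler_sqr ?nnegrE //; exact: imax.
rewrite sumr_const card_ord exprMn -[leLHS]mulr_natl.
by apply: ler_wpM2r; rewrite ?exprn_ge0 // expr2 ler_peMr.
Qed.

Lemma enorm_gt0 x : x != 0 -> 0 < enorm x.
Proof.
move=> x0; rewrite sqrtr_gt0 lt_neqAle eq_sym sumr_ge0 ?andbT; last first.
  by move=> i _; exact: sqr_ge0.
apply: contraNneq x0 => h; apply/eqP/colP => i; rewrite mxE; apply/eqP.
rewrite -sqrf_eq0; move/eqP: h; rewrite psumr_eq0 => [/allP|k _]; last exact: sqr_ge0.
by move/(_ i); rewrite mem_index_enum => /(_ isT).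
Qed.

Lemma dot_le (phi v : 'cV[R]_n) (C : R) :
  (forall i, `|v i 0| <= C) -> `|dot phi v| <= (\sum_i `|phi i 0|) * C.
Proof.
move=> hC; rewrite /dot mulr_suml; apply: le_trans (ler_norm_sum _ _ _) _.
by apply: ler_sum => i _; rewrite normrM ler_wpM2l.
Qed.

(** If x_i is a coordinate of x of largest size, then x_i phi(y) is the value of
    phi at x_i y - y_i x, whose coordinates are coordinates of x /\ y. *)
Lemma dot_kernel_le (phi x y : 'cV[R]_n) : x != 0 -> dot phi x = 0 ->
  `|dot phi y| * enorm x <= n%:R * (\sum_i `|phi i 0|) * wedge_norm x y.
Proof.
move=> x0 phix; have [i xi0 xi] := enorm_le_coord x0.
apply: le_trans (ler_wpM2l (normr_ge0 _) xi) _.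
rewrite mulrCA -mulrA ler_wpM2l // -normrM mulrC.
have -> : x i 0 * dot phi y = dot phi (x i 0 *: y - y i 0 *: x).
  have -> : dot phi (x i 0 *: y - y i 0 *: x) = x i 0 * dot phi y - y i 0 * dot phi x.
    rewrite /dot !mulr_sumr -sumrB; apply: eq_bigr => j _; rewrite !mxE; ring.
  by rewrite phix mulr0 subr0.
apply: dot_le => j; rewrite !mxE [y i 0 * _]mulrC; exact: coord_wedge_norm.
Qed.

(** The last hypothesis says that y /\ P = 0.  So P = y /\ v, where v is row k
    of P divided by y_k, and (phi /\ chi)(P) = phi(y) chi(v) - chi(y) phi(v),
    where phi(y) and chi(y) are controlled by [dot_kernel_le].  Choosing y_k of
    largest size makes v at most n H / |y|. *)
Lemma wedge_form_le (phi chi x y : 'cV[R]_n) (P : 'I_n -> 'I_n -> R) (L H : R) :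
  x != 0 -> y != 0 -> dot phi x = 0 -> dot chi x = 0 ->
  \sum_i `|phi i 0| <= L -> \sum_i `|chi i 0| <= L ->
  (forall i j, `|P i j| <= H) ->
  (forall i j k, y k 0 * P i j = y i 0 * P k j - y j 0 * P k i) ->
  `|\sum_i \sum_j phi i 0 * chi j 0 * P i j| <=
     2 * (n%:R * L) ^+ 2 * H * psi x y.
Proof.
move=> x0 y0 phix chix phiL chiL PH yP.
have [k yk0 yk] := enorm_le_coord y0.
have ex := enorm_gt0 x0; have ey := enorm_gt0 y0.
have id : y k 0 * (\sum_i \sum_j phi i 0 * chi j 0 * P i j) =
  dot phi y * dot chi (\col_j P k j) - dot chi y * dot phi (\col_i P k i).
  rewrite /dot mulr_sumr !big_distrlr /= [X in _ - X]exchange_big /= -sumrB.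
  apply: eq_bigr => i _; rewrite mulr_sumr -sumrB; apply: eq_bigr => j _.
  by rewrite mulrCA yP !mxE; ring.
set F := \sum_i _ in id *.
set W := wedge_norm x y; have W0 : 0 <= W by exact: sqrtr_ge0.
have L0 : 0 <= L by apply: le_trans phiL; exact: sumr_ge0.
have H0 : 0 <= H by apply: le_trans (PH k k).
have n0 : (0 : R) <= n%:R by [].
have hk (g : 'cV[R]_n) : dot g x = 0 -> \sum_i `|g i 0| <= L ->
    `|dot g y| * enorm x <= n%:R * L * W.
  move=> gx gL; apply: le_trans (dot_kernel_le y x0 gx) _.
  by rewrite ler_wpM2r // ler_wpM2l.
have hP (g : 'cV[R]_n) : \sum_i `|g i 0| <= L -> `|dot g (\col_j P k j)| <= L * H.
  move=> gL; apply: le_trans (dot_le _ (C := H) _) _; last exact: ler_wpM2r.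
  by move=> i; rewrite mxE.
have step : `|y k 0| * `|F| * enorm x <= 2 * n%:R * L ^+ 2 * H * W.
  rewrite -normrM id.
  apply: le_trans (ler_wpM2r (ltW ex) (ler_normB _ _)) _.
  rewrite mulrDl !normrM.
  have b1 : `|dot phi y| * enorm x * `|dot chi (\col_j P k j)| <= n%:R * L * W * (L * H).
    by apply: ler_pM; rewrite ?mulr_ge0 ?(ltW ex) ?hk ?hP.
  have b2 : `|dot chi y| * enorm x * `|dot phi (\col_j P k j)| <= n%:R * L * W * (L * H).
    by apply: ler_pM; rewrite ?mulr_ge0 ?(ltW ex) ?hk ?hP.
  move: b1 b2; rewrite ![_ * enorm x * _]mulrAC; lra.
rewrite /psi -/W mulrA ler_pdivlMr ?mulr_gt0 //.
apply: (@le_trans _ _ (`|F| * enorm x * (n%:R * `|y k 0|))).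
  by rewrite [leLHS]mulrA; apply: ler_wpM2l; rewrite // mulr_ge0 // ltW.
have -> : `|F| * enorm x * (n%:R * `|y k 0|) = n%:R * (`|y k 0| * `|F| * enorm x) by ring.
have -> : 2 * (n%:R * L) ^+ 2 * H * W = n%:R * (2 * n%:R * L ^+ 2 * H * W) by ring.
exact: ler_wpM2l.
Qed.

(** The nonzero integer multiples of the Plucker vector of a plane, as
    antisymmetric arrays. *)
Definition plucker_of (B : {vspace 'cV[R]_n}) (p : 'I_n -> 'I_n -> int) : Prop :=
  exists m1 m2 : 'cV[R]_n, exists2 c : R, B = <<[:: m1; m2]>>%VS &
    (forall i j, (p i j)%:~R = c * (m1 i 0 * m2 j 0 - m2 i 0 * m1 j 0)) /\
    exists i, exists j, p i j != 0.

Lemma mem_span2P (m1 m2 y : 'cV[R]_n) :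
  reflect (exists s u, y = s *: m1 + u *: m2) (y \in <<[:: m1; m2]>>%VS).
Proof.
rewrite span_cons span_seq1; apply: (iffP memv_addP) => [[_ /vlineP[s ->] [_ /vlineP[u ->] ->]]|[s [u ->]]].
  by exists s, u.
by exists (s *: m1); rewrite ?memvZ ?memv_line //; exists (u *: m2); rewrite ?memvZ ?memv_line.
Qed.

(** A plane is recovered from its Plucker vector p as the set of y such that
    y /\ p = 0. *)
Lemma mem_plucker_of (B : {vspace 'cV[R]_n}) p y : plucker_of B p ->
  (y \in B) <-> forall i j k, y k 0 * (p i j)%:~R =
                y i 0 * (p k j)%:~R - y j 0 * (p k i)%:~R.
Proof.
move=> [m1 [m2 [c -> [pE [i0 [j0 p0]]]]]]; split.
  move=> /mem_span2P[s [u ->]] i j k; rewrite !pE !mxE; ring.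
move=> h; apply/mem_span2P.
have p0' : (p i0 j0)%:~R != 0 :> R by rewrite intr_eq0.
exists ((y i0 0 * m2 j0 0 - y j0 0 * m2 i0 0) * c / (p i0 j0)%:~R),
       ((y j0 0 * m1 i0 0 - y i0 0 * m1 j0 0) * c / (p i0 j0)%:~R).
apply/colP => k; rewrite !mxE; apply: (mulIf p0').
rewrite h 2!pE mulrDl.
by rewrite mulrAC divfK // [X in _ = _ + X]mulrAC divfK //; ring.
Qed.

Lemma plucker_of_inj (B B' : {vspace 'cV[R]_n}) p :
  plucker_of B p -> plucker_of B' p -> B = B'.
Proof.
move=> hB hB'; apply/vspaceP => y; apply/idP/idP.
  by move/(mem_plucker_of y hB)/(mem_plucker_of y hB').
by move/(mem_plucker_of y hB')/(mem_plucker_of y hB).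
Qed.

Lemma plucker_relation (B : {vspace 'cV[R]_n}) p i j k l : plucker_of B p ->
  p i j * p k l - p i k * p j l + p i l * p j k = 0.
Proof.
move=> [m1 [m2 [c _ [pE _]]]]; apply/eqP; rewrite -(eqr_int R).
by rewrite rmorphD rmorphB /= !rmorphM /= !pE; apply/eqP; ring.
Qed.

Lemma plucker_antisym (B : {vspace 'cV[R]_n}) p i j : plucker_of B p ->
  p j i = - p i j.
Proof.
move=> [m1 [m2 [c _ [pE _]]]]; apply/eqP; rewrite -(eqr_int R) rmorphN /= !pE.
by apply/eqP; ring.
Qed.

Lemma plucker_diag (B : {vspace 'cV[R]_n}) p i : plucker_of B p -> p i i = 0.
Proof. by move=> /(plucker_antisym i i); lia. Qed.

End Norms.

(** * The height of a rational plane *)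

Lemma dvdz_big_gcdz (T : eqType) (r : seq T) (z : T -> int) i :
  i \in r -> (\big[gcdz/0]_(j <- r) z j %| z i)%Z.
Proof.
elim: r => // j r IH; rewrite in_cons big_cons => /orP[/eqP ->|/IH h].
  exact: dvdz_gcdl.
by apply: dvdz_trans h; exact: dvdz_gcdr.
Qed.

Lemma big_gcdz_ge0 (T : Type) (r : seq T) (z : T -> int) :
  0 <= \big[gcdz/0]_(j <- r) z j.
Proof. by case: r => [|j r]; rewrite ?big_nil ?big_cons. Qed.

Lemma big_gcdz_mull (T : Type) (r : seq T) (g : int) (z : T -> int) :
  0 <= g -> \big[gcdz/0]_(j <- r) (g * z j) = g * \big[gcdz/0]_(j <- r) z j.
Proof.
move=> g0; elim: r => [|j r IH]; first by rewrite !big_nil mulr0.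
by rewrite !big_cons IH -mulz_gcdr gez0_abs.
Qed.

(** Clear denominators, then divide by the greatest common divisor. *)
Lemma primitive_multiple (T : finType) (q : T -> rat) :
  (exists I, q I != 0) ->
  exists2 Xi : T -> int, \big[gcdz/0]_I Xi I = 1 &
    exists2 c : rat, c != 0 & forall I, (Xi I)%:~R = c * q I.
Proof.
move=> [I0 qI0].
pose D : int := \prod_J denq (q J).
have D0 : D != 0 by apply/prodf_neq0 => J _; exact: denq_neq0.
pose z I := numq (q I) * \prod_(J | J != I) denq (q J).
have zE I : (z I)%:~R = D%:~R * q I.
  rewrite -[q I]divq_num_den /D (bigD1 I) //= /z !rmorphM /=.
  by field; rewrite intr_eq0 denq_neq0.
set g := \big[gcdz/0]_I z I.
have gz I : (g %| z I)%Z by apply: dvdz_big_gcdz; exact: mem_index_enum.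
have g_ge0 : 0 <= g by exact: big_gcdz_ge0.
have g0 : g != 0.
  apply: contraNneq qI0 => g0; have := gz I0; rewrite g0 dvd0z => /eqP z0.
  have := zE I0; rewrite z0 => /esym/eqP; rewrite mulf_eq0 intr_eq0.
  by rewrite (negPf D0).
exists (fun I => (z I %/ g)%Z).
  apply: (mulfI g0); rewrite mulr1 -big_gcdz_mull // /g.
  by apply: eq_bigr => I _; rewrite -/g mulrC divzK.
exists (D%:~R / g%:~R); first by rewrite mulf_neq0 ?invr_eq0 ?intr_eq0.
move=> I; have g0' : g%:~R != 0 :> rat by rewrite intr_eq0.
by apply: (mulIf g0'); rewrite -rmorphM /= divzK // zE mulrAC divfK.
Qed.

Lemma det_mx2 (R : comNzRingType) (A : 'M[R]_2) :
  \det A = A 0 0 * A 1 1 - A 0 1 * A 1 0.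
Proof.
rewrite (expand_det_row _ 0) !big_ord_recl big_ord0 addr0 /cofactor !det_mx11 !mxE /=.
rewrite expr0 mul1r expr1 mulN1r mulrN.
by congr (A _ _ * A _ _ - A _ _ * A _ _); apply: val_inj.
Qed.

Lemma pair_index_subproof (n : nat) (i j : 'I_n) : (i < j)%N ->
  [forall a : 'I_2, forall b : 'I_2, (a < b)%N ==>
    ([ffun k : 'I_2 => if k == ord0 then i else j] a <
     [ffun k : 'I_2 => if k == ord0 then i else j] b)%N].
Proof.
move=> ij; apply/forallP => -[[|[|//]] ha]; apply/forallP => -[[|[|//]] hb] //=.
by rewrite !ffunE /=.
Qed.

Definition pair_index (n : nat) (i j : 'I_n) (ij : (i < j)%N) : minor_index 2 n :=
  @exist {ffun 'I_2 -> 'I_n} _ [ffun k : 'I_2 => if k == ord0 then i else j]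
    (pair_index_subproof ij).

Lemma minor2 (R : realType) (n : nat) (M : 'M[R]_(n, 2)) (I : minor_index 2 n) :
  minor M I = M (val I 0) 0 * M (val I 1) 1 - M (val I 0) 1 * M (val I 1) 0.
Proof. by rewrite /minor det_mx2 !mxE. Qed.

Lemma minor_pair_index (R : realType) (n : nat) (M : 'M[R]_(n, 2)) (i j : 'I_n)
    (ij : (i < j)%N) :
  minor M (pair_index ij) = M i 0 * M j 1 - M i 1 * M j 0.
Proof. by rewrite minor2 /= !ffunE. Qed.

Lemma enum_ord2 : enum 'I_2 = [:: 0; 1].
Proof. by apply: (inj_map val_inj); rewrite val_enum_ord. Qed.

Lemma free2_minor (R : realType) (n : nat) (M : 'M[R]_(n, 2)) :
  free [:: col 0 M; col 1 M] -> exists I, minor M I != 0.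
Proof.
rewrite free_cons seq1_free span_seq1 => /andP[ncol c1]; apply: contrapT => h.
have all0 i j : M i 0 * M j 1 = M i 1 * M j 0.
  case: (ltngtP i j) => [ij|ji|/val_inj ->]; last by rewrite mulrC.
    apply/eqP; rewrite -subr_eq0 -(minor_pair_index M ij); apply/eqP.
    by apply/eqP; apply: contrapT => /negP nz; apply: h; exists (pair_index ij).
  apply/eqP; rewrite eq_sym -subr_eq0 mulrC [X in _ - X]mulrC.
  rewrite -(minor_pair_index M ji).
  by apply: contrapT => /negP nz; apply: h; exists (pair_index ji).
have [j cj] : exists j, M j 1 != 0.
  apply/existsP; apply: contraNT c1; rewrite negb_exists => /forallP hz.
  by apply/eqP/colP => k; move: (hz k); rewrite negbK !mxE => /eqP.
move/negP: ncol; apply; apply/vlineP; exists (M j 0 / M j 1).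
by apply/colP => i; rewrite !mxE; apply: (mulIf cj); rewrite all0 mulrAC divfK // mulrC.
Qed.

(** The number of columns d is a variable so that the lemma applies with
    d := \dim B, as in the definition of the height, where \dim B is not
    convertible to 2. *)
Lemma primitive_plucker_exists (R : realType) (n d : nat) (B : {vspace 'cV[R]_n}) :
  d = 2%N -> rational_subspaces 2 B ->
  exists2 Xi : minor_index d n -> int, \big[gcdz/0]_I Xi I = 1 &
  exists M : 'M[R]_(n, d), basis_of B [seq col k M | k <- enum 'I_d] /\
    exists2 c : R, c != 0 & forall I, (Xi I)%:~R = c * minor M I.
Proof.
move=> -> [dimB [s sB]].
have : size [seq map_mx (ratr : rat -> R) w | w <- s] = 2%N.
  by rewrite -dimB; move: (size_basis (X := in_tuple _) sB).
case: s sB => [|v1 [|v2 [|? ?]]] //= sB _.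
pose Mq : 'M[rat]_(n, 2) := \matrix_(i, k) (if k == 0 then v1 i 0 else v2 i 0).
pose M : 'M[R]_(n, 2) := map_mx (ratr : rat -> R) Mq.
have bM : basis_of B [seq col k M | k <- enum 'I_2].
  rewrite enum_ord2 /=; have -> : col 0 M = map_mx (ratr : rat -> R) v1.
    by apply/colP => i; rewrite !mxE.
  suff -> : col 1 M = map_mx (ratr : rat -> R) v2 by [].
  by apply/colP => i; rewrite !mxE.
have minE I : minor M I = ratr (\det (rowsub (val I) Mq)).
  by rewrite /minor -det_map_mx; congr (\det _); apply/matrixP => i k; rewrite !mxE.
have [I0 mI0] : exists I, minor M I != 0.
  by apply: free2_minor; move: (basis_free bM); rewrite enum_ord2.
have [|Xi Xi1 [c c0 cE]] := @primitive_multiple _ (fun I : minor_index 2 n => \det (rowsub (val I) Mq)).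
  by exists I0; move: mI0; rewrite minE fmorph_eq0.
exists Xi => //; exists M; split => //; exists (ratr c); first by rewrite fmorph_eq0.
by move=> I; rewrite minE -rmorphM -cE /= ratr_int.
Qed.

Lemma plucker_of_minors (R : realType) (n d : nat) (B : {vspace 'cV[R]_n})
    (Xi : minor_index d n -> int) (M : 'M[R]_(n, d)) (c : R) :
  d = 2%N -> \big[gcdz/0]_I Xi I = 1 -> basis_of B [seq col k M | k <- enum 'I_d] ->
  (forall I, (Xi I)%:~R = c * minor M I) ->
  exists2 p, plucker_of B p & forall i j, `|p i j|%:~R <= Num.sqrt (\sum_I (Xi I)%:~R ^+ 2) :> R.
Proof.
move=> d2; move: Xi M; rewrite d2 => Xi M Xi1; rewrite enum_ord2 /= => bM XiE.
set h := Num.sqrt _.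
have Xih I : `|Xi I|%:~R <= h.
  rewrite intr_norm -sqrtr_sqr /h ler_wsqrtr // (bigD1 I) //= lerDl sumr_ge0 //.
  by move=> J _; exact: sqr_ge0.
have [I0 XI0] : exists I, Xi I != 0.
  apply: contrapT => hz; have : \big[gcdz/0]_I Xi I = 0; last by rewrite Xi1.
  have -> : \big[gcdz/0]_I Xi I = \big[gcdz/0]_I (0 * Xi I).
    apply: eq_bigr => I _; rewrite mul0r; apply/eqP; apply: contrapT => /negP nz.
    by apply: hz; exists I.
  by rewrite big_gcdz_mull // mul0r.
have pex (ij : 'I_n * 'I_n) : exists z : int,
    z%:~R = c * (M ij.1 0 * M ij.2 1 - M ij.1 1 * M ij.2 0) /\ `|z|%:~R <= h.
  case: ij => i j /=; case: (ltngtP i j) => [ij|ji|/val_inj ->].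
  - by exists (Xi (pair_index ij)); rewrite XiE minor_pair_index.
  - exists (- Xi (pair_index ji)); rewrite rmorphN /= XiE minor_pair_index normrN.
    by split => //; ring.
  - exists 0; rewrite normr0; split; last exact: sqrtr_ge0.
    by rewrite rmorph0; ring.
have [f fE] := choice pex.
exists (fun i j => f (i, j)); last by move=> i j; case: (fE (i, j)).
exists (col 0 M), (col 1 M), c; first by rewrite (span_basis bM).
split.
  by move=> i j; case: (fE (i, j)) => -> _; rewrite !mxE.
exists (val I0 0), (val I0 1); rewrite -(intr_eq0 R).
by case: (fE (val I0 0, val I0 1)) => -> _; rewrite /= -minor2 -XiE intr_eq0.
Qed.

(** The height is a choice among the norms of the primitive Plucker vectors of B;
    whichever it is, it bounds the coordinates of the vector it comes from. *)
Lemma height_plucker (R : realType) (n : nat) (B : {vspace 'cV[R]_n}) :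
  rational_subspaces 2 B ->
  exists2 p, plucker_of B p & forall i j, `|p i j|%:~R <= height B.
Proof.
move=> rB; have dimB : \dim B = 2%N by case: rB.
have [Xi0 Xi01 [M0 [bM0 cM0]]] := primitive_plucker_exists dimB rB.
rewrite /height; case: xgetP => [h _ [Xi [Xi1 [M [bM [c _ XiE]]]] ->]|noX].
  exact: plucker_of_minors dimB Xi1 bM XiE.
exfalso; apply: (noX (Num.sqrt (\sum_I (Xi0 I)%:~R ^+ 2))).
by exists Xi0 => //; split => //; exists M0.
Qed.

(** * The planes of the conic *)

Notation o5 k := (@Ordinal 5 k isT).

Lemma sum5 (V : nmodType) (F : 'I_5 -> V) :
  \sum_i F i = F (o5 0) + F (o5 1) + F (o5 2) + F (o5 3) + F (o5 4).
Proof.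
rewrite !big_ord_recl big_ord0 addr0 !addrA.
by congr (_ + _ + _ + _ + _); congr F; apply: val_inj.
Qed.

Lemma ord5P (i : 'I_5) :
  [\/ i = o5 0, i = o5 1, i = o5 2 | i = o5 3 \/ i = o5 4].
Proof.
case: i => [[|[|[|[|[|//]]]]] h];
  [apply: Or41|apply: Or42|apply: Or43|apply: Or44; left|apply: Or44; right];
  exact: val_inj.
Qed.

Definition vec5 (R : realType) (l : seq R) : 'cV[R]_5 := \col_i nth 0 l i.

Section Plane.
Variables (R : realType) (t : R).
Hypothesis t01 : 0 <= t <= 1.
Let g := Num.sqrt (3 - t ^+ 2).

(** The plane A of the proof and the linear forms that cut it out. *)
Definition gen1 : 'cV[R]_5 := vec5 [:: 1; Num.sqrt (3 - t ^+ 2); 0; - t; 0].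
Definition gen2 : 'cV[R]_5 := vec5 [:: 0; t; 1; Num.sqrt (3 - t ^+ 2); 0].
Definition conic_plane : {vspace 'cV[R]_5} := <<[:: gen1; gen2]>>%VS.

Definition phi1 : 'cV[R]_5 := vec5 [:: - Num.sqrt (3 - t ^+ 2); 1; - t; 0; 0].
Definition phi2 : 'cV[R]_5 := vec5 [:: t; 0; - Num.sqrt (3 - t ^+ 2); 1; 0].
Definition phi3 : 'cV[R]_5 := vec5 [:: 0; 0; 0; 0; 1].

Lemma conic_plane_kernel x : x \in conic_plane ->
  [/\ dot phi1 x = 0, dot phi2 x = 0 & dot phi3 x = 0].
Proof.
by move=> /mem_span2P[s [u ->]]; split; rewrite /dot sum5 !mxE /=; ring.
Qed.

Lemma dim_conic_plane : \dim conic_plane = 2%N.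
Proof.
have : free [:: gen1; gen2].
  rewrite free_cons seq1_free span_seq1; apply/andP; split.
    apply/negP => /vlineP[s /colP/(_ (o5 0))]; rewrite !mxE /= mulr0.
    by move/eqP; rewrite oner_eq0.
  by apply/eqP => /colP/(_ (o5 2)); rewrite !mxE /= => /eqP; rewrite oner_eq0.
by rewrite /free => /eqP.
Qed.

Let g0 : 0 <= g. Proof. exact: sqrtr_ge0. Qed.
Let g2 : g ^+ 2 = 3 - t ^+ 2.
Proof. by rewrite sqr_sqrtr //; move: t01 => /andP[]; nra. Qed.
Let g_le2 : g <= 2.
Proof.
rewrite -(ler_pXn2r (ltn0Sn 1)) ?nnegrE // g2; have := sqr_ge0 t; lra.
Qed.

Lemma phi_norm1 phi : phi \in [:: phi1; phi2; phi3] -> \sum_i `|phi i 0| <= 4.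
Proof.
move: t01 => /andP[t0 t1].
rewrite !inE => /or3P[] /eqP ->; rewrite sum5 !mxE /= -/g ?normrN ?normr0 ?normr1
  ?(ger0_norm g0) ?(ger0_norm t0); have := g_le2; lra.
Qed.

Variables (kappa theta : R).
Hypothesis Happ : forall (k : nat) (a b c : int), (a != 0) || (b != 0) ->
      `|a| < (2 ^ k)%N%:Z -> `|b| < (2 ^ k)%N%:Z ->
      kappa * (theta / 4) ^+ k <
        `|a%:~R * t + b%:~R * Num.sqrt (3 - t ^+ 2) - c%:~R|.

(** If a = b = 0 the form is a nonzero integer; the hypothesis on t, applied to
    the triple (1, 0, 0), shows that the lower bound to be proved is at most 1. *)
Lemma nonzero_form_le (k : nat) (a b c : int) (h : R) : (0 < k)%N ->
  [|| a != 0, b != 0 | c != 0] ->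
  `|a| < (2 ^ k)%N%:Z -> `|b| < (2 ^ k)%N%:Z ->
  `|a%:~R * t + b%:~R * g - c%:~R| <= h -> kappa * (theta / 4) ^+ k <= h.
Proof.
move=> k0; rewrite orbA => nz ak bk hh; apply: le_trans hh.
case: (boolP ((a != 0) || (b != 0))) nz => [ab _|].
  by apply: ltW; exact: Happ.
rewrite negb_or !negbK => /andP[/eqP -> /eqP ->] /= c0.
rewrite !mul0r addr0 sub0r normrN.
apply: (@le_trans _ _ 1); last by rewrite -intr_norm ler1z -gtz0_ge1 normr_gt0.
have k2 : (1 < 2 ^ k)%N by rewrite -{1}(expn0 2) ltn_exp2l.
have := @Happ k 1 0 0 isT; rewrite normr1 normr0 => /(_ _ _)/ltW; rewrite mul0r addr0 subr0 mul1r.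
move: t01 => /andP[t0 t1].
rewrite ger0_norm // => /(_ k2 (ltnW k2)) /le_trans; exact.
Qed.

(** If all these integers vanish, the Plucker relation expressed in p01, p12 and
    p02 is the equation of the conic, and all coordinates of p are zero. *)
Lemma plucker_nonzero_forms (B : {vspace 'cV[R]_5}) p : plucker_of B p ->
  [|| p (o5 2) (o5 4) != 0, p (o5 0) (o5 4) != 0 | p (o5 1) (o5 4) != 0] ||
  (p (o5 3) (o5 4) != 0) ||
  [|| p (o5 0) (o5 1) + p (o5 2) (o5 3) != 0,
      p (o5 1) (o5 2) + p (o5 0) (o5 3) != 0
    | p (o5 1) (o5 3) + 3 * p (o5 0) (o5 2) != 0].
Proof.
move=> hp; apply/negPn/negP; rewrite !negb_or !negbK.
move=> /andP[/andP[/and3P[/eqP p24 /eqP p04 /eqP p14] /eqP p34] /and3P[/eqP e1 /eqP e2 /eqP e3]].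
have rel := plucker_relation (o5 0) (o5 1) (o5 2) (o5 3) hp.
have conic : (3 * p (o5 0) (o5 2)) ^+ 2 = 3 * (p (o5 0) (o5 1) ^+ 2 + p (o5 1) (o5 2) ^+ 2).
  have f1 : p (o5 2) (o5 3) = - p (o5 0) (o5 1) by apply/eqP; rewrite -addr_eq0 addrC e1.
  have f2 : p (o5 0) (o5 3) = - p (o5 1) (o5 2) by apply/eqP; rewrite -addr_eq0 addrC e2.
  have f3 : p (o5 1) (o5 3) = - (3 * p (o5 0) (o5 2)) by apply/eqP; rewrite -addr_eq0 e3.
  apply/eqP; rewrite -subr_eq0; apply/eqP.
  by rewrite -[RHS](mulr0 3) -rel f1 f2 f3; ring.
have [p01 p12 p02'] := conic_anisotropic conic.
have p02 : p (o5 0) (o5 2) = 0 by lia.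
have p23 : p (o5 2) (o5 3) = 0 by lia.
have p03 : p (o5 0) (o5 3) = 0 by lia.
have p13 : p (o5 1) (o5 3) = 0 by lia.
have diag i := plucker_diag i hp.
have [_ [_ [_ _ [_ [i [j /negP pij]]]]]] := hp; apply: pij.
have as_ a b : p b a = 0 -> p a b = 0.
  by move=> h; rewrite (plucker_antisym b a hp) h oppr0.
by case: (ord5P i) => [->|->|->|[->|->]]; case: (ord5P j) => [->|->|->|[->|->]];
  rewrite ?diag //; apply/eqP; first [assumption | apply: as_; assumption].
Qed.

(** The three forms of [plucker_nonzero_forms] are the contractions of p with
    phi1 /\ phi3, phi2 /\ phi3 and phi1 /\ phi2; the coefficient 3 of p02 in the
    last one is t^2 + g^2.  The integers a and b of each triple are at most 2 H,
    being sums of at most two coordinates, and 800 = 2 (5 * 4)^2 comes from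
    [wedge_form_le] in dimension 5 with the bound of [phi_norm1]. *)
Lemma psi_lower_bound (B : {vspace 'cV[R]_5}) p (H : R) (k : nat) x y :
  plucker_of B p -> (forall i j, `|p i j|%:~R <= H) -> 2 * H < (2 ^ k)%N%:R ->
  x \in conic_plane -> x != 0 -> y \in B -> y != 0 ->
  kappa * (theta / 4) ^+ k <= 800 * H * psi x y.
Proof.
move=> hp pH Hk xA x0 yB y0.
have [x1 x2 x3] := conic_plane_kernel xA.
pose P (i j : 'I_5) : R := (p i j)%:~R.
have PH i j : `|P i j| <= H by rewrite /P -intr_norm.
have yP := (mem_plucker_of y hp).1 yB.
have bound phi chi : phi \in [:: phi1; phi2; phi3] -> chi \in [:: phi1; phi2; phi3] ->
    dot phi x = 0 -> dot chi x = 0 ->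
    `|\sum_i \sum_j phi i 0 * chi j 0 * P i j| <= 800 * H * psi x y.
  move=> m1 m2 d1 d2.
  apply: le_trans (wedge_form_le x0 y0 d1 d2 (phi_norm1 m1) (phi_norm1 m2) PH yP) _.
  rewrite le_eqVlt; apply/orP; left; apply/eqP; ring.
have pA i j : P j i = - P i j by rewrite /P (plucker_antisym i j hp) rmorphN.
have pD i : P i i = 0.
  by rewrite /P (plucker_diag i hp).
have b12 : `|(p (o5 0) (o5 1) + p (o5 2) (o5 3))%:~R * t +
     (p (o5 1) (o5 2) + p (o5 0) (o5 3))%:~R * g
     - (p (o5 1) (o5 3) + 3 * p (o5 0) (o5 2))%:~R| <= 800 * H * psi x y.
  apply: le_trans (bound phi1 phi2 _ _ x1 x2); rewrite ?inE ?eqxx ?orbT //.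
  rewrite -normrN le_eqVlt; apply/orP; left; apply/eqP; congr `|_|.
  rewrite sum5 !sum5 !mxE /= -/g !pD (pA (o5 0) (o5 1)) (pA (o5 0) (o5 2))
    (pA (o5 1) (o5 2)) (pA (o5 2) (o5 3)).
  rewrite !rmorphD rmorphM /= -!/(P _ _).
  have -> : 3%:~R = t ^+ 2 + g ^+ 2 :> R by rewrite g2 addrC subrK.
  ring.
have b13 : `|(p (o5 2) (o5 4))%:~R * t + (p (o5 0) (o5 4))%:~R * g
     - (p (o5 1) (o5 4))%:~R| <= 800 * H * psi x y.
  apply: le_trans (bound phi1 phi3 _ _ x1 x3); rewrite ?inE ?eqxx ?orbT //.
  rewrite -normrN le_eqVlt; apply/orP; left; apply/eqP; congr `|_|.
  by rewrite sum5 !sum5 !mxE /= -/g -!/(P _ _); ring.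
have b23 : `|(- p (o5 0) (o5 4))%:~R * t + (p (o5 2) (o5 4))%:~R * g
     - (p (o5 3) (o5 4))%:~R| <= 800 * H * psi x y.
  apply: le_trans (bound phi2 phi3 _ _ x2 x3); rewrite ?inE ?eqxx ?orbT //.
  rewrite -normrN le_eqVlt; apply/orP; left; apply/eqP; congr `|_|.
  by rewrite sum5 !sum5 !mxE /= -/g rmorphN /= -!/(P _ _); ring.
have H1 : 1 <= H.
  have [_ [_ [_ _ [_ [i [j pij]]]]]] := hp; apply: le_trans (pH i j).
  by rewrite ler1z -gtz0_ge1 normr_gt0.
have k0 : (0 < k)%N by case: k Hk => //; rewrite expn0; lra.
have small a : `|a|%:~R <= 2 * H -> `|a| < (2 ^ k)%N%:Z.
  by move=> ha; rewrite -(ltr_int R); apply: le_lt_trans Hk.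
have small1 i j : `|p i j| < (2 ^ k)%N%:Z by apply: small; have := pH i j; lra.
have small2 i j i' j' : `|p i j + p i' j'| < (2 ^ k)%N%:Z.
  apply: small; apply: (@le_trans _ _ (`|p i j| + `|p i' j'|)%:~R).
    by rewrite ler_int ler_normD.
  by rewrite rmorphD /=; have := pH i j; have := pH i' j'; lra.
case/orP: (plucker_nonzero_forms hp) => [/orP[nz|nz]|nz].
- exact: nonzero_form_le b13.
- by apply: nonzero_form_le b23 => //; rewrite ?normrN // nz !orbT.
- exact: nonzero_form_le b12.
Qed.

End Plane.

(** * The exponent *)

Lemma psi_self (R : realType) (n : nat) (x : 'cV[R]_n) : psi x x = 0.
Proof.
rewrite /psi /wedge_norm big1 ?sqrtr0 ?mul0r // => i _; rewrite big1 // => k _.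
by rewrite [X in _ - X]mulrC subrr expr0n.
Qed.

Lemma exists_mem_neq0 (R : realType) (n : nat) (B : {vspace 'cV[R]_n}) :
  (0 < \dim B)%N -> exists2 x, x \in B & x != 0.
Proof.
move=> dB; exists (vpick B); first exact: memv_pick.
by rewrite vpick0 -dimv_eq0 -lt0n.
Qed.

Lemma le_angle1 (R : realType) (n : nat) (A B : {vspace 'cV[R]_n}) (z : R) :
  (0 < \dim A)%N -> (0 < \dim B)%N ->
  (forall x y, x \in A -> x != 0 -> y \in B -> y != 0 -> z <= psi x y) ->
  z <= angle 1 A B.
Proof.
move=> /exists_mem_neq0[x0 x0A x00] /exists_mem_neq0[y0 y0B y00] h.
apply: lb_le_inf.
  by exists (psi x0 y0), (x0, y0) => //; split.
by move=> _ [[x y] [/= xA xn yB yn _] <-]; exact: h.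
Qed.

(** A plane is determined by its Plucker vector, whose coordinates are integers
    of absolute value at most N. *)
Lemma finite_bounded_height (R : realType) (n N : nat) :
  finite_set [set B : {vspace 'cV[R]_n} | rational_subspaces 2 B /\ height B <= N%:R].
Proof.
pose decode (f : {ffun 'I_n * 'I_n -> 'I_(N.*2.+1)}) (i j : 'I_n) : int :=
  (f (i, j))%:Z - N%:Z.
pose F f : {vspace 'cV[R]_n} := xget 0%VS [set B | plucker_of B (decode f)].
apply: (@sub_finite_set _ _ (F @` setT)); last first.
  by apply: finite_image; exact: finite_finset.
move=> B [rB hB]; have [p pB ph] := height_plucker rB.
have pN i j : `|p i j| <= N%:Z.
  by rewrite -(ler_int R); apply: le_trans hB.
exists [ffun ij => inord (absz (p ij.1 ij.2 + N%:Z))] => //.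
have dE : decode [ffun ij => inord (absz (p ij.1 ij.2 + N%:Z))] = p.
  apply/funext => i; apply/funext => j; rewrite /decode ffunE /= inordK.
    by have := pN i j; clear; lia.
  by have := pN i j; clear; lia.
rewrite /F dE; case: xgetP => [B' _ /= hB'|/(_ B) /(_ pB) //].
exact: plucker_of_inj hB' pB.
Qed.

Lemma exists_pow2 (R : realType) (H : R) : 1 <= H ->
  exists2 k : nat, 2 * H < (2 ^ k)%N%:R & ((2 ^ k)%N%:R : R) <= 4 * H.
Proof.
move=> H1; have ex : exists k, 2 * H < (2 ^ k)%N%:R.
  exists (Num.bound (2 * H)); apply: (lt_trans (archi_boundP _)); first lra.
  by rewrite ltr_nat ltn_expl.
case: (ex_minnP ex) => k hk kmin; exists k => //.
case: k hk kmin => [|k] hk kmin; first by rewrite expn0; lra.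
have : ~~ (2 * H < (2 ^ k)%N%:R) by apply/negP => /kmin; rewrite ltnn.
by rewrite -leNgt expnS natrM; lra.
Qed.

Lemma pow_powR (R : realType) (e : R) (k : nat) :
  (2 `^ (- e) / 4) ^+ k = (2 ^ k)%N%:R `^ (- (2 + e)) :> R.
Proof.
have -> : 2 `^ (- e) / 4 = 2 `^ (- (2 + e)) :> R.
  have e4 : (4 : R)^-1 = 2 `^ (- 2) by rewrite powR_invn // -natrX.
  by rewrite opprD powRD ?pnatr_eq0 ?implybT // -e4 mulrC.
by rewrite -powR_mulrn ?powR_ge0 // -powRrM mulrC powRrM powR_mulrn // natrX.
Qed.

Lemma powR2_lt1 (R : realType) (e : R) : 0 < e -> 0 < (2 : R) `^ (- e) < 1.
Proof.
move=> e0; rewrite powR_gt0 //= powRN invf_lt1 ?powR_gt0 //.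
have : (1 : R) `^ e < 2 `^ e by apply: gt0_ltr_powR; rewrite ?nnegrE // ltr1n.
by rewrite powR1.
Qed.

(** The inequality amounts to H^(beta - 3 - e) <= 800 4^(2 + e) / kappa. *)
Lemma powR_growth_bound (R : realType) (kappa e beta H : R) :
  0 < kappa -> 1 <= H -> 3 + e < beta ->
  kappa * (4 * H) `^ (- (2 + e)) <= 800 * H * H `^ (- beta) ->
  H <= (800 / kappa * 4 `^ (2 + e)) `^ (beta - (3 + e))^-1.
Proof.
move=> k0 H1 eb h.
have H0 : 0 < H by lra.
have Hn0 : H != 0 by exact: lt0r_neq0.
set C := 800 / kappa * _.
have C0 : 0 <= C.
  apply: mulr_ge0; last exact: powR_ge0.
  by rewrite divr_ge0 ?ler0n ?(ltW k0).
have d0 : 0 < beta - (3 + e) by lra.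
have key : H `^ (beta - (3 + e)) <= C.
  have p0 : 0 < H `^ beta by exact: powR_gt0.
  have q0 : 0 < (4 * H) `^ (2 + e) by apply: powR_gt0; lra.
  have -> : beta - (3 + e) = beta + (- (2 + e)) + (- 1) by ring.
  rewrite powRD ?Hn0 ?implybT // powRD ?Hn0 ?implybT // powR_inv1 ?(ltW H0) // powRN.
  move: h; rewrite !powRN ler_pdivlMr // mulrAC ler_pdivrMr //.
  rewrite powRM ?(ltW H0) // /C => h.
  have r0 : 0 < H `^ (2 + e) by exact: powR_gt0.
  rewrite !ler_pdivrMr //.
  rewrite -(ler_pM2l k0); apply: le_trans h _.
  by rewrite le_eqVlt; apply/orP; left; apply/eqP; field; exact: lt0r_neq0.
have -> : H = (H `^ (beta - (3 + e))) `^ (beta - (3 + e))^-1.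
  by rewrite -powRrM mulfV ?lt0r_neq0 // powRr1 // ltW.
by apply: ge0_ler_powR; rewrite ?nnegrE ?powR_ge0 // invr_ge0 ltW.
Qed.

Lemma height_ge1 (R : realType) (B : {vspace 'cV[R]_5}) p :
  plucker_of B p -> (forall i j, `|p i j|%:~R <= height B) -> 1 <= height B.
Proof.
move=> [_ [_ [_ _ [_ [i [j pij]]]]]] pH; apply: le_trans (pH i j).
by rewrite ler1z -gtz0_ge1 normr_gt0.
Qed.

(** Taking theta = 2^(-e) and 2 H < 2^k <= 4 H, where H is the height of B, the
    lower bound kappa (theta / 4)^k is at least kappa (4 H)^(-2-e).  The plane
    meets every rational plane B in 0 only, because psi vanishes on the pair
    (v, v) for a common vector v. *)
Lemma mu_ring_le (R : realType) (e : R) : 0 < e -> (mu_ring R 5 2 2 1 <= (3 + e)%:E)%E.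
Proof.
move=> e0.
have [kappa k0 [t t01 Happ]] := exists_badly_approximable (powR2_lt1 e0).
have low := psi_lower_bound t01 Happ.
pose A := conic_plane t.
have dimA : \dim A = 2%N := dim_conic_plane t.
have th0 k : 0 < kappa * (2 `^ (- e) / 4) ^+ k.
  by rewrite pow_powR mulr_gt0 ?powR_gt0 // ltr0n expn_gt0.
have irr : irrational_subspaces 2 2 1 A.
  split => // B rB; rewrite ltnS leqNgt; apply/negP => /exists_mem_neq0[v].
  rewrite memv_cap => /andP[vA vB] v0.
  have [p pB pH] := height_plucker rB.
  have [k Hk _] := exists_pow2 (height_ge1 pB pH).
  have := low _ _ _ k _ _ pB pH Hk vA v0 vB v0.
  by rewrite psi_self mulr0 leNgt th0.
apply: (@le_trans _ _ (mu 2 1 A)); first by apply: ereal_inf_lbound; exists A.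
apply: ge_ereal_sup => _ [beta [b0 binf] <-]; rewrite lee_fin leNgt.
apply/negP => eb; apply: binf.
set C := (800 / kappa * 4 `^ (2 + e)) `^ (beta - (3 + e))^-1.
apply: (sub_finite_set _ (@finite_bounded_height R 5 (Num.bound C))).
move=> B [rB hB]; split => //.
have [p pB pH] := height_plucker rB.
have H1 := height_ge1 pB pH.
have [k Hk kH] := exists_pow2 H1.
apply: (@le_trans _ _ C); last by apply/ltW/archi_boundP/powR_ge0.
apply: powR_growth_bound => //.
have H0 : 0 < 800 * height B by lra.
have dimB : \dim B = 2%N by case: rB.
apply: (@le_trans _ _ (800 * height B * angle 1 A B)); last by rewrite ler_pM2l.
rewrite mulrC -ler_pdivrMl //; apply: le_angle1; rewrite ?dimA ?dimB // => x y xA x0 yB y0.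
rewrite ler_pdivrMl // mulrC; apply: le_trans (low _ _ _ k _ _ pB pH Hk xA x0 yB y0).
rewrite pow_powR ler_pM2l // !powRN lef_pV2 ?posrE ?powR_gt0 ?ltr0n ?expn_gt0 //; last lra.
by apply: ge0_ler_powR; rewrite ?nnegrE //; lra.
Qed.

Theorem proposition5p6 (R : realType) :
  (mu_ring R 5 2 2 1 <= 3%:E)%E.
Proof.
apply/lee_addgt0Pr => e e0; rewrite -EFinD; exact: mu_ring_le.
Qed.
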